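(* Let $d\ge2$. Every convex body in $\mathbb{R}^d$ symmetric about the origin is realizable.
   Context: A linear switching system in $\mathbb{R}^d$ is identified with its control set $\mathcal{A}$, a nonempty compact set of real $d\times d$ matrices. A trajectory is an absolutely continuous function $x:[0,\infty)\to\mathbb{R}^d$ such that $\dot x(t)=A(t)x(t)$ for almost every $t$, for some measurable function $A(\cdot):[0,\infty)\to\mathcal{A}$. The Lyapunov exponent $\sigma(\mathcal{A})$ is the infimum of all $\beta\in\mathbb{R}$ such that every trajectory satisfies $\|x(t)\|\le C e^{\beta t}$ for all $t\ge0$ with a constant $C$ depending on the trajectory. Standing assumption: $\mathcal{A}$ is convex and the corresponding normalized system $\mathcal{A}-\sigma(\mathcal{A})I=\{A-\sigma(\mathcal A)I: A\in\mathcal{A}\}$ does not contain the zero matrix, i.e. $\sigma(\mathcal{A})I\notin\mathcal{A}$. For a compact set $M\subset\mathbb{R}^d$ and $t\ge 0$, $M_t$ denotes the set of points $x(t)$ over all trajectories with $x(0)\in M$. An eigenset of $\mathcal{A}$ is a compact set $M\ne\emptyset$, $M\neq\{0\}$, for which there is $\alpha\in\mathbb{R}$ with $M_t=e^{\alpha t}M$ for all $t\ge0$. The system is irreducible if the matrices of $\mathcal{A}$ have no common invariant linear subspace other than $\{0\}$ and $\mathbb{R}^d$. A compact set $M\subset\mathbb{R}^d$ is realizable if there exists an irreducible linear switching system $\mathcal{A}$ for which $M$ is an eigenset. A convex body is a convex compact set with nonempty interior. *)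

(* Defs.v *)
From mathcomp Require Import all_boot all_order all_algebra.
From mathcomp Require Import all_classical all_reals all_analysis.
From mathcomp Require Import measurable_realfun.
Import Order.TTheory GRing.Theory Num.Theory.
Import numFieldNormedType.Exports.

Set Implicit Arguments.
Unset Strict Implicit.
Unset Printing Implicit Defensive.

Local Open Scope classical_set_scope.
Local Open Scope ring_scope.

Section Defs.
Context {R : realType}.

Definition abs_continuous_on (V : normedModType R) (a b : R) (f : R -> V) :=
  forall e : R, 0 < e -> exists2 delta : R, 0 < delta &
    forall (n : nat) (I : 'I_n -> R * R),
      (forall i, a <= (I i).1 /\ (I i).1 <= (I i).2 /\ (I i).2 <= b) ->
      trivIset setT (fun i => [set` `](I i).1, (I i).2[]) ->
      \sum_(i < n) ((I i).2 - (I i).1) < delta ->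
      \sum_(i < n) `|f (I i).2 - f (I i).1| < e.

(* On the half-line absolute continuity is understood on every compact
   interval; the global epsilon-delta condition on [0, +oo) would exclude the
   exponentially growing solutions. *)
Definition abs_continuous (V : normedModType R) (f : R -> V) :=
  forall T : R, abs_continuous_on 0 T f.

(* R with the Lebesgue sigma-algebra: the library's measurable sets of R are
   the Borel sets, which are completed here by the null sets. *)
Definition lebesgueType :=
  g_sigma_algebraType (completed_algebra_gen (@lebesgue_measure R)).

Section SwitchingSystem.
Context {d : nat}.
Implicit Types (S : set 'M[R]_d) (M : set 'cV[R]_d).

(* Functions on [0, +oo) are encoded as functions on R whose values at negative
   arguments are ignored. *)
Definition switching_law S (A : R -> 'M[R]_d) :=
  (forall t : R, 0 <= t -> S (A t)) /\
  (forall i j, measurable_fun (`[0, +oo[ : set lebesgueType)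
                 ((fun t => A t i j) : lebesgueType -> R)).

Definition trajectory S (x : R -> 'cV[R]_d) :=
  abs_continuous x /\
  exists2 A : R -> 'M[R]_d, switching_law S A &
    {ae (@lebesgue_measure R), forall t : R, 0 <= t ->
       is_derive t 1 x (A t *m x t)}.

(* `|_| is the maximum norm; the exponent does not depend on the norm. For d > 0
   and S nonempty compact the set is nonempty and bounded below, so that inf is
   the genuine infimum. *)
Definition lyapunov S : R :=
  inf [set beta : R | forall x, trajectory S x ->
         exists C : R, forall t : R, 0 <= t -> `|x t| <= C * expR (beta * t)].

Definition normalized S : set 'M[R]_d := [set A - (lyapunov S)%:M | A in S].

Definition switching_system S :=
  [/\ S !=set0, compact S,
      convex_set (S : set (convex_lmodType 'M[R]_d)) & ~ normalized S 0].

Definition irreducible S :=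
  forall U : {vspace 'cV[R]_d},
    (forall A, S A -> forall u, u \in U -> A *m u \in U) ->
    U = 0%VS \/ U = fullv.

Definition reach S M (t : R) : set 'cV[R]_d :=
  [set x t | x in [set x | trajectory S x /\ M (x 0)]].

Definition eigenset S M :=
  [/\ compact M, M !=set0, M <> [set 0] &
      exists alpha : R, forall t : R, 0 <= t ->
        reach S M t = [set expR (alpha * t) *: v | v in M]].

Definition realizable M :=
  exists S, [/\ switching_system S, irreducible S & eigenset S M].

Definition convex_body M :=
  [/\ compact M, convex_set (M : set (convex_lmodType 'cV[R]_d)) &
      M° !=set0].

Definition origin_symmetric M := forall x, M x -> M (- x).

End SwitchingSystem.
End Defs.

(* Main.v *)
Require Import Defs.
From mathcomp Require Import all_boot all_order all_algebra.
From mathcomp Require Import all_classical all_reals all_analysis.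
From mathcomp Require Import measurable_realfun lra ring.
Import Order.TTheory GRing.Theory Num.Theory.
Import numFieldNormedType.Exports.

Set Implicit Arguments.
Unset Strict Implicit.
Unset Printing Implicit Defensive.

Local Open Scope classical_set_scope.
Local Open Scope ring_scope.

(** Let S be the set of matrices of trace 1 that map G into itself, that is, of
    operator norm at most 1 for the norm p with unit ball G. The value p (x t)
    of a trajectory grows at most like e^t, while every x <> 0 is fixed by a
    matrix of S, namely the rank one projection x f / p x with f a norming
    functional of x. Hence e^t x is a trajectory, G_t = e^t G and the exponent
    is 1, and S contains no scalar matrix but I / d. If a subspace U contains
    u <> 0, the projection onto x = u + s v for small s > 0 does not kill u, so
    that x and hence v lie in U: the system is irreducible. *)

(** * Absolutely continuous functions with nonpositive derivative *)

Section AbsoluteContinuity.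
Context {R : realType}.

(** Continuous induction: at the supremum of the s with [Q a s], the local hypothesis extends [Q]
    from some s just below it to a point beyond it, unless b is reached first. *)
Lemma cousin (Q : R -> R -> Prop) (a b : R) : a <= b ->
  (forall u w v, a <= u -> u <= w -> w <= v -> v <= b ->
     Q u w -> Q w v -> Q u v) ->
  (forall t, a <= t <= b -> exists2 r : R, 0 < r &
     forall u v, a <= u -> u <= t -> t <= v -> v <= b ->
       t - r < u -> v < t + r -> Q u v) ->
  Q a b.
Proof.
move=> ab Qadd Qloc; pose X := [set s | a <= s <= b /\ Q a s].
have Xa : X a.
  split; first by rewrite lexx.
  have [r r0 Qr] := Qloc a ltac:(by rewrite lexx).
  by apply: Qr => //; lra.
have supX : has_sup X by split; [exists a | exists b => s [/andP[]]].
have Xsup s : X s -> s <= sup X by apply: ub_le_sup; case: supX.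
have asup : a <= sup X by exact: Xsup.
have supb : sup X <= b by apply: ge_sup; [exists a | move=> s [/andP[]]].
have [r r0 Qr] := Qloc (sup X) ltac:(by rewrite asup).
have [s Xs ls] := sup_adherent r0 supX.
have s_sup := Xsup _ Xs; case: Xs => /andP[as_ sb] Qas.
have [bv|vb] := leP b (sup X + r / 2).
  by apply: (Qadd a s b) => //; apply: Qr => //; lra.
have Xv : X (sup X + r / 2).
  split; first by apply/andP; split; lra.
  by apply: (Qadd a s) => //; try lra; apply: Qr => //; lra.
by have := Xsup _ Xv; lra.
Qed.

Lemma sum_lengths_le (U : set R) n (I : 'I_n -> R * R) : measurable U ->
  (forall i, (I i).1 <= (I i).2) ->
  (forall i, [set` `](I i).1, (I i).2[] `<=` U) ->
  trivIset setT (fun i => [set` `](I i).1, (I i).2[]) ->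
  ((\sum_(i < n) ((I i).2 - (I i).1))%:E <= lebesgue_measure U)%E.
Proof.
move=> mU I12 IU tI.
have -> : ((\sum_(i < n) ((I i).2 - (I i).1))%:E =
    lebesgue_measure (\big[setU/set0]_(i < n) [set` `](I i).1, (I i).2[]))%E.
  rewrite measure_bigsetU_ord// -sumEFin; apply: eq_bigr => i _.
  rewrite [RHS]lebesgue_measure_itv/= lte_fin; case: ltP => // I21.
  by rewrite (le_anti (introT andP (conj (I12 i) I21))) subrr.
apply: le_measure; rewrite ?inE//.
  by apply: bigsetU_measurable => i _; exact: measurable_itv.
by elim/big_ind : _ => // A B AU BU x [/AU|/BU].
Qed.

(** Sorted lists replace families indexed by ['I_n], so that the chains of two adjacent intervals
    concatenate to a chain. *)
Definition chain (a b : R) (s : seq (R * R)) :=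
  all (fun p => [&& a <= p.1, p.1 <= p.2 & p.2 <= b]) s &&
  pairwise (fun p q => p.2 <= q.1) s.

Lemma chain_trivIset a b s : chain a b s -> forall i0,
  trivIset setT (fun i : 'I_(size s) =>
    [set` `](nth i0 s i).1, (nth i0 s i).2[]).
Proof.
move=> /andP[_ sp] i0; apply/trivIsetP => i j _ _.
wlog ij : i j / (i < j)%N.
  move=> wl ij; have [lij|ji|e] := ssrnat.ltngtP i j; first exact: wl.
    by rewrite setIC; apply: wl => //; rewrite eq_sym.
  by move/val_inj : e ij => ->; rewrite eqxx.
move=> _; rewrite -subset0 => x [] /=.
rewrite !in_itv/= => /andP[_ x1] /andP[x2 _].
have := (pairwiseP i0 sp i j); rewrite !inE => /(_ (ltn_ord i) (ltn_ord j) ij).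
by lra.
Qed.

Lemma abs_continuous_chain (V : normedModType R) (a b : R) (f : R -> V) :
  abs_continuous_on a b f -> forall e : R, 0 < e -> exists2 delta : R, 0 < delta &
  forall s, chain a b s -> \sum_(p <- s) (p.2 - p.1) < delta ->
  \sum_(p <- s) `|f p.2 - f p.1| < e.
Proof.
move=> fac e /fac[delta d0 fd]; exists delta => // s sab.
rewrite !(big_nth (0, 0)) !big_mkord; apply: fd; last first.
  exact: chain_trivIset sab _.
by move=> i; case/andP : sab => /allP/(_ _ (mem_nth (0, 0) (ltn_ord i)))/and3P[].
Qed.

(* The exceptional null set is covered by an open set U of small measure; around
   its points the increment of h is paid for by a chain of intervals in U, on
   which absolute continuity bounds the total increment. *)
Lemma abs_continuous_nonincreasing (a b : R) (h : R -> R) (E : set R) :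
  a <= b -> (@lebesgue_measure R).-negligible E ->
  (forall e : R, 0 < e -> exists2 delta : R, 0 < delta &
    forall s, chain a b s -> \sum_(p <- s) (p.2 - p.1) < delta ->
    \sum_(p <- s) (h p.2 - h p.1) < e) ->
  (forall t, a <= t <= b -> ~ E t -> forall e : R, 0 < e ->
    exists2 r : R, 0 < r & forall u v, a <= u -> u <= t -> t <= v -> v <= b ->
       t - r < u -> v < t + r -> h v - h u <= e * (v - u)) ->
  h b <= h a.
Proof.
move=> ab [N [mN N0 EN]] hac hloc; apply/ler_addgt0Pr => e e0.
(* This slope contributes at most e / 2 over [a, b]; the + 1 allows a = b. *)
have e1 : 0 < e / (2 * (b - a + 1)) by apply: divr_gt0; lra.
have e2 : 0 < e / 2 by lra.
have [delta d0 hd] := hac _ e2.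
have Noo : (@lebesgue_measure R N < +oo)%E by rewrite N0.
have [U [oU NU mUN]] := lebesgue_regularity_outer mN Noo d0.
have mU : measurable U by exact: open_measurable.
have mUd : (lebesgue_measure U < delta%:E)%E.
  rewrite -(setDUK NU); apply: le_lt_trans mUN.
  have := @measureU2 _ _ _ (@lebesgue_measure R) N (U `\` N) mN (measurableD mU mN).
  by rewrite [X in (_ <= X + _)%E]N0 add0e.
(* This bound is additive over adjacent intervals. Near a point of E the chain is the single
   interval [(u, v)], near any other point it is empty. *)
pose Q u v := exists s, [/\ chain u v s,
  (forall p, p \in s -> [set` `]p.1, p.2[] `<=` U) &
  h v - h u <= e / (2 * (b - a + 1)) * (v - u) + \sum_(p <- s) (h p.2 - h p.1)].
have [u w v au uw wv vb|t tab|s [sab sU hs]] := @cousin Q a b ab.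
- move=> [s [/andP[/allP s1 s2] sU hs]] [s' [/andP[/allP s'1 s'2] s'U hs']].
  exists (s ++ s'); split; last 1 first.
  + by rewrite big_cat/=; lra.
  + rewrite /chain all_cat pairwise_cat s2 s'2 !andbT -andbA; apply/and3P; split.
    * by apply/allP => p /s1; lra.
    * by apply/allP => p /s'1; lra.
    * by apply/allrelP => p q /s1 + /s'1; lra.
  + by move=> p; rewrite mem_cat => /orP[/sU|/s'U].
- have [Et|nEt] := pselect (E t).
    have /(open_nbhs_nbhs)/nbhs_ballP[r /= r0 rU] : open_nbhs t U.
      by split => //; apply/NU/EN.
    exists r => // u v au ut tv vb tu vt; exists [:: (u, v)]; split.
    + by rewrite /chain/= !lexx; lra.
    + move=> p; rewrite inE => /eqP -> /= x; rewrite /= in_itv/= => /andP[ux xv].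
      by apply: rU; rewrite /ball/= ltr_distlC; lra.
    + by rewrite big_seq1/= lerDr mulr_ge0//; lra.
  have [r r0 hr] := hloc t tab nEt _ e1.
  exists r => // u v au ut tv vb tu vt; exists [::]; split => //.
  by rewrite big_nil addr0; exact: hr.
have slt : \sum_(p <- s) (p.2 - p.1) < delta.
  rewrite -lte_fin; apply: le_lt_trans mUd.
  rewrite (big_nth (0, 0)) big_mkord; apply: sum_lengths_le => //.
  - by move=> i; case/andP : sab => /allP/(_ _ (mem_nth (0, 0) (ltn_ord i)))/and3P[].
  - by move=> i; apply/sU/mem_nth.
  - exact: chain_trivIset sab _.
have := hd _ sab slt.
have : e / (2 * (b - a + 1)) * (b - a) <= e / 2.
  rewrite -[X in X <= _]mulrA ler_pM2l// invfM -mulrA ler_piMr//.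
  by rewrite mulrC ler_pdivrMr; lra.
lra.
Qed.

End AbsoluteContinuity.

(** * The Hahn-Banach theorem and gauges *)

Section HahnBanach.
Context {R : realType}.

Definition sublinear (V : lmodType R) (p : V -> R) :=
  (forall x y, p (x + y) <= p x + p y) /\
  (forall c x, 0 <= c -> p (c *: x) = c * p x).

Lemma sublinear0 (V : lmodType R) (p : V -> R) : sublinear p -> p 0 = 0.
Proof. by move=> [_ pZ]; rewrite -(scale0r 0) pZ// mul0r. Qed.

Lemma sublinearNge0 (V : lmodType R) (p : V -> R) x : sublinear p ->
  0 <= p x + p (- x).
Proof. by move=> sp; rewrite -(sublinear0 sp) -(subrr x); case: sp. Qed.

(* The minorant is [y |-> inf_(t >= 0) p (y + t v) - t p v], which is linear in
   the direction of v. *)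
Lemma sublinear_minorant (V : lmodType R) (p : V -> R) (v : V) : sublinear p ->
  exists q, [/\ sublinear q, forall y, q y <= p y & q (- v) <= - p v].
Proof.
move=> sp; have [pD pZ] := sp; have p0 := sublinear0 sp.
pose X y := [set p (y + t *: v) - t * p v | t in [set t | 0 <= t]].
(* The infimum is finite because t p v = p (t v) <= p (y + t v) + p (- y). *)
have Xlb y : lbound (X y) (- p (- y)).
  move=> _ [t t0 <-]; have := pD (y + t *: v) (- y).
  by rewrite addrAC subrr add0r pZ//=; lra.
have X0 y : X y !=set0.
  by exists (p (y + 0 *: v) - 0 * p v); exists 0 => /=.
have infX y t : 0 <= t -> inf (X y) <= p (y + t *: v) - t * p v.
  by move=> t0; apply: ge_inf; [exists (- p (- y)) | exists t].
have qp y : inf (X y) <= p y.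
  by have := infX y 0 (lexx 0); rewrite scale0r addr0; lra.
have qZ_le c y : 0 < c -> inf (X (c *: y)) <= c * inf (X y).
  move=> c0; rewrite -ler_pdivrMl//; apply: lb_le_inf => // _ [t /= t0 <-].
  rewrite ler_pdivrMl//; have := infX (c *: y) (c * t) ltac:(by rewrite mulr_ge0// ltW).
  by rewrite -scalerA -scalerDr pZ ?(ltW c0)// mulrBr mulrA.
exists (fun y => inf (X y)); split => //; last first.
  have := infX (- v) 1 ler01; rewrite scale1r addNr p0; lra.
split=> [x y|c x].
  rewrite -lerBlDr; apply: lb_le_inf => // _ [t /= t0 <-].
  rewrite lerBlDl -lerBlDr; apply: lb_le_inf => // _ [s /= s0 <-].
  have := infX (x + y) (t + s) ltac:(by rewrite addr_ge0).
  have := pD (x + t *: v) (y + s *: v).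
  by rewrite addrACA -scalerDl; lra.
rewrite le_eqVlt => /predU1P[<-|c0].
  rewrite mul0r scale0r; apply/eqP; rewrite eq_le -{1}p0 qp/=.
  by apply: lb_le_inf => // z /Xlb; rewrite oppr0 p0 oppr0.
apply/eqP; rewrite eq_le qZ_le//= -ler_pdivlMl//.
rewrite -[x in X x]scale1r -(mulVf (lt0r_neq0 c0)) -scalerA.
by apply: qZ_le; rewrite invr_gt0.
Qed.

(** The directions can be treated one after another, since linearity along v survives in any smaller
    sublinear r: r (- v) <= q (- v) <= - p v <= - r v. *)
Lemma sublinear_minorant_seq (V : lmodType R) (s : seq V) (p : V -> R) :
  sublinear p -> exists q, [/\ sublinear q, forall y, q y <= p y &
    {in s, forall v, q (- v) <= - q v}].
Proof.
elim: s p => [|v s IH] p sp; first by exists p.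
have [q [sq qp qv]] := sublinear_minorant v sp.
have [r [sr rq rs]] := IH _ sq; exists r; split => //.
  by move=> y; apply: le_trans (rq y) (qp y).
move=> w; rewrite inE => /predU1P[->|/rs//].
by have := rq (- v); have := rq v; have := qp v; lra.
Qed.

(** A minorant q linear along x, then a minorant r of q linear along the standard basis, determine f
    by its values on the basis. The value at x follows from f (- x) <= r (- x) <= q (- x) <= - p
    x. *)
Theorem hahn_banach_cV d (p : 'cV[R]_d -> R) (x : 'cV[R]_d) : sublinear p ->
  exists f : 'rV[R]_d, (forall y, (f *m y) 0 0 <= p y) /\ (f *m x) 0 0 = p x.
Proof.
move=> sp; have [q [sq qp qx]] := sublinear_minorant x sp.
have [r [sr rq rN]] := sublinear_minorant_seq [seq delta_mx i 0 | i : 'I_d] sq.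
have [rD rZ] := sr.
pose f : 'rV[R]_d := \row_i r (delta_mx i 0).
have f_le y : (f *m y) 0 0 <= r y.
  (* Subadditivity bounds r from above only, so it is applied to - y and turned around with 0 <= r y
     + r (- y). *)
  suff : r (- y) <= - (f *m y) 0 0 by have := sublinearNge0 y sr; lra.
  have -> : - y = \sum_i (- y i 0) *: delta_mx i 0 :> 'cV_d.
    rewrite {1}[y]matrix_sum_delta -sumrN; apply: eq_bigr => i _.
    by rewrite big_ord1 scaleNr.
  rewrite !mxE -sumrN.
  elim/big_ind2 : _ => [|a b c e ab ce|i _]; first by rewrite (sublinear0 sr).
    by apply: le_trans (rD _ _) _; apply: lerD.
  rewrite mxE mulrC -mulNr; have [yi|yi] := leP 0 (- y i 0); first by rewrite rZ.
  rewrite -[- y i 0 *: _]opprK -scaleNr -scalerN opprK rZ; last by lra.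
  have /rN : (delta_mx i 0 : 'cV[R]_d) \in [seq delta_mx i 0 | i : 'I_d].
    by apply/mapP; exists i; rewrite ?mem_enum.
  move=> rNi; have : y i 0 * r (- delta_mx i 0) <= y i 0 * - r (delta_mx i 0).
    by rewrite ler_pM2l//; lra.
  by rewrite mulrN mulNr.
have fp y : (f *m y) 0 0 <= p y by apply: le_trans (f_le y) (le_trans (rq y) (qp y)).
exists f; split => //; apply/eqP; rewrite eq_le fp/=.
have := f_le (- x); rewrite mulmxN mxE; have := rq (- x); lra.
Qed.

End HahnBanach.

(** * Minkowski gauges of closed convex sets containing a ball around 0 *)

Section Gauge.
Context {R : realType} {V : normedModType R}.

(** The Minkowski functional. The value r = 0 is excluded, as [0^-1 = 0] would admit it whenever G
    contains 0. *)
Definition gauge (G : set V) (x : V) : R :=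
  inf [set r | 0 < r /\ G (r^-1 *: x)].

Variables (G : set V) (e : R).
Hypotheses (e0 : 0 < e) (eG : forall x, `|x| <= e -> G x) (cG : closed G).
Hypothesis convG : forall t x y, 0 <= t <= 1 -> G x -> G y ->
  G (t *: x + (1 - t) *: y).

Let G0 : G 0. Proof. by apply: eG; rewrite normr0 ltW. Qed.

Let gauge_set0 x : [set r | 0 < r /\ G (r^-1 *: x)] !=set0.
Proof.
have r0 : 0 < `|x| / e + 1 by rewrite ltr_wpDl// divr_ge0// ltW.
exists (`|x| / e + 1); split => //; apply: eG.
rewrite normrZ gtr0_norm ?invr_gt0// ler_pdivrMl// mulrDl mul1r divfK ?gt_eqF//.
by rewrite lerDl ltW.
Qed.

Lemma gauge_le (r : R) x : 0 < r -> G (r^-1 *: x) -> gauge G x <= r.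
Proof. by move=> r0 Gx; apply: ge_inf => //; exists 0 => s [/ltW]. Qed.

Lemma gauge_ge0 x : 0 <= gauge G x.
Proof. by apply: lb_le_inf => // s [/ltW]. Qed.

(** Some s < r has x / s in G, and x / r is a convex combination of x / s and 0. *)
Lemma gauge_lt (r : R) x : gauge G x < r -> G (r^-1 *: x).
Proof.
move=> /(inf_lt (gauge_set0 x))[s [s0 Gs] sr].
have r0 : 0 < r by exact: lt_trans sr.
have -> : r^-1 *: x = (s / r) *: (s^-1 *: x) + (1 - s / r) *: 0.
  by rewrite scaler0 addr0 scalerA mulrAC divff ?gt_eqF// mul1r.
apply: convG => //; apply/andP; split; first by rewrite divr_ge0 ?ltW.
by rewrite ler_pdivrMr// mul1r ltW.
Qed.

(** For a > p x and b > p y, with p the gauge, (x + y) / (a + b) is the convex combination of x / a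
    and y / b with weights a / (a + b) and b / (a + b). *)
Lemma gauge_sublinear : sublinear (gauge G).
Proof.
have gZ_le c x : 0 < c -> gauge G (c *: x) <= c * gauge G x.
  move=> c0; rewrite -ler_pdivrMl//; apply: lb_le_inf => // s [s0 Gs].
  rewrite ler_pdivrMl//; apply: gauge_le; first exact: mulr_gt0.
  by rewrite scalerA invfM mulrAC mulVf ?mul1r// gt_eqF.
split=> [x y|c x].
  apply/ler_addgt0Pr => r r0.
  have [gx gy] : gauge G x < gauge G x + r / 2 /\ gauge G y < gauge G y + r / 2.
    by split; lra.
  have := gauge_lt gx; have := gauge_lt gy; have := gauge_ge0 x; have := gauge_ge0 y.
  set b := gauge G y + r / 2; set a := gauge G x + r / 2 => y0 x0 Gy Gx.
  have a0 : 0 < a by rewrite /a; lra.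
  have b0 : 0 < b by rewrite /b; lra.
  have -> : gauge G x + gauge G y + r = a + b by rewrite /a /b; field.
  apply: gauge_le; first exact: addr_gt0.
  have -> : (a + b)^-1 *: (x + y) =
      (a / (a + b)) *: (a^-1 *: x) + (1 - a / (a + b)) *: (b^-1 *: y).
    rewrite !scalerA scalerDr; congr (_ *: _ + _ *: _); field; lra.
  apply: convG => //; rewrite divr_ge0/= ?ler_pdivrMr; lra.
rewrite le_eqVlt => /predU1P[<-|c0].
  rewrite mul0r scale0r; apply/eqP; rewrite eq_le gauge_ge0 andbT.
  apply/ler_addgt0Pr => r r0; rewrite add0r; apply: gauge_le => //.
  by rewrite scaler0.
apply/eqP; rewrite eq_le gZ_le//= -ler_pdivlMl//.
rewrite -[x in X in X <= _]scale1r -(mulVf (lt0r_neq0 c0)) -scalerA.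
by apply: gZ_le; rewrite invr_gt0.
Qed.

(** If the gauge is at most 1, the points x / (1 + d) with d > 0 lie in G; they tend to x and G is
    closed. *)
Lemma gauge_le1 x : gauge G x <= 1 <-> G x.
Proof.
split=> [g1|Gx]; last by apply: gauge_le => //; rewrite invr1 scale1r.
apply: cG => B /nbhs_ballP[r /= r0 rB].
(* For this d the distance from x to x / (1 + d) is d |x| / (1 + d) < r. *)
have d0 : 0 < r / (`|x| + 1) by rewrite divr_gt0// ltr_wpDl.
set d := r / _ in d0; exists ((1 + d)^-1 *: x); split.
  by apply: gauge_lt; lra.
apply: rB; rewrite -ball_normE/=.
rewrite -[x in x - _]scale1r -scalerBl normrZ.
have -> : 1 - (1 + d)^-1 = d / (1 + d) by field; lra.
rewrite ger0_norm; last by rewrite divr_ge0; lra.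
rewrite mulrAC ltr_pdivrMr; last by lra.
have -> : r = d * (`|x| + 1) by rewrite divfK// gt_eqF// ltr_wpDl.
clearbody d; rewrite -mulrA ltr_pM2l//.
have := normr_ge0 x; nra.
Qed.

Lemma gauge_norm x : gauge G x <= e^-1 * `|x|.
Proof.
have [->|x0] := eqVneq x 0.
  by rewrite (sublinear0 gauge_sublinear) normr0 mulr0.
apply: gauge_le; first by rewrite mulr_gt0 ?invr_gt0 ?normr_gt0.
apply: eG; rewrite normrZ invfM invrK gtr0_norm.
  by rewrite divfK// normr_eq0.
by rewrite divr_gt0 ?normr_gt0.
Qed.

End Gauge.

(** * Matrix norms and exponential trajectories *)

Section MatrixNorm.
Context {R : realType}.

Lemma mx_entry_norm m n (A : 'M[R]_(m, n)) i j : `|A i j| <= `|A|.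
Proof.
rewrite [leRHS]/Num.norm/= mx_normrE; apply/bigmax_geP; right.
by exists (i, j).
Qed.

Lemma mx_norm_le m n (A : 'M[R]_(m, n)) c : 0 <= c ->
  (forall i j, `|A i j| <= c) -> `|A| <= c.
Proof.
move=> c0 Ac; rewrite [leLHS]/Num.norm/= mx_normrE; apply/bigmax_leP.
by split=> // -[i j] _; exact: Ac.
Qed.

(** The factor n is due to the maximum norm. The right side is arranged as a constant times |A|, the
    form that continuity in A calls for. *)
Lemma mulmx_norm m n k (A : 'M[R]_(m, n)) (B : 'M[R]_(n, k)) :
  `|A *m B| <= n%:R * `|B| * `|A|.
Proof.
apply: mx_norm_le => [|i j]; first by rewrite !mulr_ge0.
rewrite mxE; apply: le_trans (ler_norm_sum _ _ _) _.
have -> : n%:R * `|B| * `|A| = \sum_(l < n) `|B| * `|A|.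
  by rewrite sumr_const card_ord -mulrA mulr_natl.
apply: ler_sum => l _; rewrite normrM mulrC.
by apply: ler_pM => //; exact: mx_entry_norm.
Qed.

Lemma mxtrace_norm n (A : 'M[R]_n) : `|\tr A| <= n%:R * `|A|.
Proof.
apply: le_trans (ler_norm_sum _ _ _) _.
have -> : n%:R * `|A| = \sum_(l < n) `|A| by rewrite sumr_const card_ord mulr_natl.
by apply: ler_sum => l _; exact: mx_entry_norm.
Qed.

Lemma bounded_additive_continuous (V W : normedModType R)
    (f : {additive V -> W}) (c : R) :
  (forall x, `|f x| <= c * `|x|) -> continuous f.
Proof.
move=> fc x; apply/cvgrPdist_lt => eps eps0.
(* The constant c may be 0 or negative; [|c| + 1] is a positive Lipschitz constant. *)
have c0 : 0 < `|c| + 1 by apply: ltr_wpDl.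
apply/nbhs_ballP; exists (eps / (`|c| + 1)) => /=; first exact: divr_gt0.
move=> y; rewrite -ball_normE/= ltr_pdivlMr// => xy.
rewrite -raddfB; apply: le_lt_trans (fc _) (le_lt_trans _ xy).
rewrite mulrC ler_wpM2l//; have := ler_norm c; lra.
Qed.

(** Heine-Borel is carried over from row vectors: A is the image under the continuous [vec_mx] of
    its preimage. *)
Lemma bounded_closed_compact_mx m n (A : set 'M[R]_(m, n)) (c : R) :
  (forall X, A X -> `|X| <= c) -> closed A -> compact A.
Proof.
move=> Ac clA.
have vcont : continuous (@vec_mx R m n).
  apply: (@bounded_additive_continuous _ _ _ 1) => u; rewrite mul1r.
  by apply: mx_norm_le => // i j; rewrite mxE mx_entry_norm.
have -> : A = @vec_mx R m n @` (@vec_mx R m n @^-1` A).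
  rewrite predeqE => X; split=> [AX|[u Au <-]//].
  by exists (mxvec X) => /=; rewrite mxvecK.
apply: continuous_compact; first exact: continuous_subspaceT.
apply: bounded_closed_compact; last by move/continuous_closedP : vcont; apply.
exists c; split; first exact: num_real.
move=> x cx u /= Au; apply: le_trans (ltW cx); apply: le_trans (Ac _ Au).
apply: mx_norm_le => // i j; rewrite ord1.
by rewrite -(vec_mxK u); case/mxvec_indexP : j => k l; rewrite mxvecE vec_mxK mx_entry_norm.
Qed.

End MatrixNorm.

(** * First order expansions and the curves e^t v *)

Section Derivative.
Context {R : realType} {V : normedModType R}.

Lemma is_derive_approx (f : R -> V) (t : R) (D : V) : is_derive t 1 f D ->
  forall e : R, 0 < e -> exists2 r : R, 0 < r &
    forall s, `|s| < r -> `|f (t + s) - f t - s *: D| <= e * `|s|.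
Proof.
move=> [df <-] e e0.
move/cvgrPdist_le : (df) => /(_ _ e0).
move=> -[r /= r0 fr]; exists r => // s sr.
have [->|s0] := eqVneq s 0.
  by rewrite addr0 subrr scale0r subr0 !normr0 mulr0.
have := fr s; rewrite /ball/= sub0r normrN => /(_ sr s0).
rewrite [s *: 1]mulr1 [s + t]addrC distrC -/(derive f t 1) => h.
rewrite -(ler_pM2l (_ : 0 < `|s|^-1)) ?invr_gt0 ?normr_gt0//.
rewrite mulrCA mulVf ?normr_eq0// mulr1 -normfV -normrZ scalerBr scalerA.
by rewrite mulVf// scale1r.
Qed.

Lemma is_derive_expR_scale (v : V) (t : R) :
  is_derive t 1 (fun s => expR s *: v) (expR t *: v).
Proof.
have [/= dexp eexp] := is_derive_expR t.
have h : (fun h : R => h^-1 *: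
    (((fun s => expR s *: v) \o shift t) (h *: (1 : R)) - expR t *: v)) @ 0^' -->
    expR t *: v.
  under eq_fun do rewrite /= -scalerBl scalerA.
  apply: cvgZr_tmp; rewrite -[X in _ --> X]eexp; exact: dexp.
split; first by apply/cvg_ex; exists (expR t *: v).
exact: cvg_lim h.
Qed.

(** The curve is Lipschitz up to time T, as e^b - e^a = e^b (1 - e^(a - b)) <= e^T (b - a). *)
Lemma abs_continuous_expR_scale (v : V) : abs_continuous (fun s => expR s *: v).
Proof.
move=> T e e0.
pose c := expR T * `|v| + 1.
have c0 : 0 < c by rewrite ltr_wpDl// mulr_ge0// expR_ge0.
exists (e / c); first exact: divr_gt0.
move=> n I I0 _; rewrite ltr_pdivlMr//; apply: le_lt_trans.
rewrite mulr_suml; apply: ler_sum => i _; have [a0 [ab bT]] := I0 i.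
rewrite -scalerBl normrZ ger0_norm; last by rewrite subr_ge0 ler_expR.
set a := (I i).1 in a0 ab *; set b := (I i).2 in ab bT *.
have eb : expR b * (1 - expR (a - b)) <= expR T * (b - a).
  apply: ler_pM; rewrite ?expR_ge0 ?ler_expR//.
    by rewrite subr_ge0 -expR0 ler_expR; lra.
  by have := expR_ge1Dx (a - b); lra.
rewrite mulrBr mulr1 -expRD [b + _]addrC subrK in eb.
have := ler_wpM2r (normr_ge0 v) eb.
by rewrite /c; nra.
Qed.

End Derivative.

(** * The system of contractions of trace 1 *)

Section Contraction.
Context {R : realType} {d : nat}.

(** The function h t = e^(- t) p (x t) is nonincreasing: to first order x (t + s) is x t + s A x t,
    and p (A x t) <= p (x t). As p need not be differentiable, the increments of h are estimated on
    either side of t. *)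
Lemma trajectory_sublinear_growth (S : set 'M[R]_d) (p : 'cV[R]_d -> R) (K : R)
    (x : R -> 'cV[R]_d) (T : R) :
  sublinear p -> 0 < K -> (forall y, 0 <= p y) -> (forall y, p y <= K * `|y|) ->
  (forall y, p (- y) = p y) -> (forall A y, S A -> p (A *m y) <= p y) ->
  trajectory S x -> 0 <= T -> p (x T) <= expR T * p (x 0).
Proof.
move=> sp K0 p0 pK pN pS [xac [A [AS _] xA]] T0; have [pD pZ] := sp.
have pBl y z : p y - p z <= p (y - z) by have := pD (y - z) z; rewrite subrK; lra.
suff : expR (- T) * p (x T) <= expR (- 0) * p (x 0).
  rewrite oppr0 expR0 mul1r -(ler_pM2l (expR_gt0 T)).
  by rewrite mulrA -expRD subrr expR0 mul1r.
apply: (abs_continuous_nonincreasing (h := fun t => expR (- t) * p (x t)) T0 xA).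
  (* Since p is K-Lipschitz and the exponential factor decreases, an increment of h is at most K
     times that of x. *)
  move=> e e0; have eK0 : 0 < e / K by exact: divr_gt0.
  have [delta delta0 xd] := abs_continuous_chain (xac T) eK0.
  exists delta => // s sT /(xd _ sT); rewrite ltr_pdivlMr// mulrC.
  apply: le_lt_trans; rewrite mulr_sumr big_seq [leRHS]big_seq.
  apply: ler_sum => -[u v] /=; case/andP: sT => /allP sT _ /sT /= /and3P[u0 uv vT].
  have v1 : expR (- v) <= 1 by rewrite -(expR0 R) ler_expR oppr_le0 (le_trans u0).
  have h1 : expR (- v) * p (x u) <= expR (- u) * p (x u).
    by rewrite ler_wpM2r// ler_expR lerN2.
  have h2 : expR (- v) * (p (x v) - p (x u)) <= expR (- v) * (K * `|x v - x u|).
    by rewrite ler_pM2l ?expR_gt0//; apply: le_trans (pBl _ _) (pK _).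
  have h3 : expR (- v) * (K * `|x v - x u|) <= K * `|x v - x u|.
    by rewrite ler_piMl// mulr_ge0// ltW.
  by rewrite mulrBr in h2; lra.
move=> t /andP[t0 tT] /contrapT/(_ t0) xt e e0.
have eK0 : 0 < e / 2 / K by rewrite divr_gt0//; lra.
have [r r0 xr] := is_derive_approx xt eK0.
set g := p (x t); have g0 : 0 <= g by exact: p0.
have err s : `|s| < r -> p (x (t + s) - x t - s *: (A t *m x t)) <= e / 2 * `|s| /\
    p (- (x (t + s) - x t - s *: (A t *m x t))) <= e / 2 * `|s|.
  have -> : e / 2 * `|s| = K * (e / 2 / K * `|s|) by field; rewrite gt_eqF.
  rewrite pN => /xr; rewrite -(ler_pM2l K0) => h.
  by split; apply: le_trans (pK _) h.
have Ag : p (A t *m x t) <= g by apply: pS; exact: AS.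
(* The growth factor 1 + s is absorbed by e^(- s) (1 + s) <= 1. *)
have right s : 0 <= s -> s < r ->
    expR (- (t + s)) * p (x (t + s)) - expR (- t) * g <= e / 2 * s.
  move=> s0 sr; have [+ _] := err s ltac:(by rewrite ger0_norm).
  rewrite ger0_norm// => es.
  have xs : p (x (t + s)) <= (1 + s) * g + e / 2 * s.
    have := pD (x t + s *: (A t *m x t)) (x (t + s) - x t - s *: (A t *m x t)).
    have -> : x t + s *: (A t *m x t) + (x (t + s) - x t - s *: (A t *m x t)) = x (t + s).
      by rewrite -[x (t + s) - _ - _]addrA -opprD [LHS]addrC subrK.
    have := pD (x t) (s *: (A t *m x t)); rewrite (pZ _ _ s0) -/g.
    by have := ler_wpM2l s0 Ag; lra.
  have c1 : expR (- s) * (1 + s) <= 1.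
    by rewrite -[leRHS](expR0 R) -(addNr s) expRD ler_pM2l ?expR_gt0// expR_ge1Dx.
  have c2 : expR (- s) <= 1 by rewrite -(expR0 R) ler_expR; lra.
  have a1 : expR (- t) <= 1 by rewrite -(expR0 R) ler_expR; lra.
  have a0 := expR_gt0 (- t); have c0 := expR_gt0 (- s).
  rewrite opprD expRD -mulrA -mulrBr.
  have h1 : expR (- s) * p (x (t + s)) <= expR (- s) * ((1 + s) * g + e / 2 * s).
    by rewrite ler_pM2l.
  have h2 : expR (- s) * (1 + s) * g <= g by rewrite ler_piMl.
  have es0 : 0 <= e / 2 * s by rewrite mulr_ge0//; lra.
  have h3 : expR (- s) * (e / 2 * s) <= e / 2 * s by rewrite ler_piMl.
  apply: (@le_trans _ _ (expR (- t) * (e / 2 * s))); last by rewrite ler_piMl.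
  by rewrite ler_pM2l//; rewrite mulrDr mulrA in h1; lra.
(* Here e^s (1 - s) >= (1 + s) (1 - s) = 1 - s^2 leaves a loss of order g s^2, which is at most (e /
   2) s once g s <= e / 2. *)
have left s : 0 <= s -> s <= t -> s < r -> s < 1 -> g * s <= e / 2 ->
    expR (- t) * g - expR (- (t - s)) * p (x (t - s)) <= e / 2 * s + e / 2 * s.
  move=> s0 st sr s1 gs; have [_] := err (- s) ltac:(by rewrite normrN ger0_norm).
  rewrite normrN ger0_norm// => es.
  have xs : (1 - s) * g - e / 2 * s <= p (x (t - s)).
    have := pD (x (t - s)) (- (x (t - s) - x t - - s *: (A t *m x t))).
    rewrite [X in p X <= _](_ : _ = x t - s *: (A t *m x t)); last first.
      by rewrite scaleNr opprK opprD opprB addrA addrCA subrr addr0.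
    have := pBl (x t) (s *: (A t *m x t)); rewrite (pZ _ _ s0) -/g.
    by have := ler_wpM2l s0 Ag; lra.
  have bE : expR (- (t - s)) = expR (- t) * expR s by rewrite -expRD opprB addrC.
  have b1 : expR (- (t - s)) <= 1 by rewrite -(expR0 R) ler_expR; lra.
  have b0 := expR_gt0 (- (t - s)).
  have a1 : expR (- t) <= 1 by rewrite -(expR0 R) ler_expR; lra.
  have a0 := expR_gt0 (- t).
  have h1 : expR (- (t - s)) * ((1 - s) * g - e / 2 * s) <=
    expR (- (t - s)) * p (x (t - s)) by rewrite ler_pM2l.
  have es0 : 0 <= e / 2 * s by rewrite mulr_ge0//; lra.
  have h2 : expR (- (t - s)) * (e / 2 * s) <= e / 2 * s by rewrite ler_piMl// ltW.
  have h3 : expR (- t) * (1 + s) <= expR (- (t - s)).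
    by rewrite bE ler_pM2l// expR_ge1Dx.
  have h4 : expR (- t) * (1 + s) * ((1 - s) * g) <= expR (- (t - s)) * ((1 - s) * g).
    by rewrite ler_wpM2r// mulr_ge0//; lra.
  have h5 : expR (- t) * (s * (g * s)) <= s * (g * s).
    by rewrite ler_piMl// !mulr_ge0.
  have h6 : s * (g * s) <= e / 2 * s by rewrite mulrC ler_wpM2r.
  by nra.
have r2 : 0 < e / 2 / (g + 1) by rewrite !divr_gt0//; lra.
(* The three bounds serve the expansion of x, the sign of 1 - s and the second order loss; g + 1
   covers g = 0. *)
exists (Num.min r (Num.min 1 (e / 2 / (g + 1)))).
  by rewrite !lt_min r0 ltr01.
move=> u v u0 ut tv vT.
set rho := Num.min _ _; have : rho <= r by rewrite ge_min lexx.
have : rho <= 1 by rewrite !ge_min lexx orbT.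
have : rho <= e / 2 / (g + 1) by rewrite !ge_min lexx !orbT.
move=> rho2 rho1 rhor tu vt.
have gs : g * (t - u) <= e / 2.
  have : t - u <= e / 2 / (g + 1) by lra.
  by rewrite ler_pdivlMr; lra.
have := right (v - t); have := left (t - u).
rewrite subKr (_ : t + (v - t) = v); last by rewrite addrC subrK.
move=> lu rv.
have := lu ltac:(lra) ltac:(lra) ltac:(lra) ltac:(lra) gs.
have := rv ltac:(lra) ltac:(lra).
have : 0 <= e / 2 * (v - t) by rewrite mulr_ge0//; lra.
rewrite -/g.
lra.
Qed.

End Contraction.

(** * The switching system attached to a symmetric convex body *)

Section TraceOneContractions.
Context {R : realType} {d : nat} (G : set 'cV[R]_d).

Definition trace1_contractions : set 'M[R]_d :=
  [set A | (forall x, G x -> G (A *m x)) /\ \tr A = 1].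
Local Notation S := trace1_contractions.

Lemma trace1_contractions_closed : closed G -> closed S.
Proof.
move=> cG.
have -> : S = (\bigcap_(x in G) ((mulmxr x) @^-1` G)) `&` (mxtrace @^-1` [set 1]).
  rewrite predeqE => A; split=> [[AG trA]|[AG trA]].
    by split => // x Gx /=; exact: AG.
  by split => // x Gx; exact: (AG x Gx).
apply: closedI.
  apply: closed_bigI => x _.
  apply: (iffLR (continuous_closedP _)) => //.
  apply: (@bounded_additive_continuous _ _ _ _ (d%:R * `|x|)) => A /=.
  exact: mulmx_norm.
apply: (iffLR (continuous_closedP _)); last exact: closed_eq.
apply: (@bounded_additive_continuous _ _ R^o _ d%:R) => A.
exact: mxtrace_norm.
Qed.

Local Notation p := (gauge G).

Lemma exp_trajectory A v : S A -> A *m v = v ->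
  trajectory S (fun t => expR t *: v).
Proof.
move=> SA Av; split; first exact: abs_continuous_expR_scale.
exists (fun _ => A); first by split => // i j; exact: measurable_cst.
apply: aeW => t _; rewrite -scalemxAr Av; exact: is_derive_expR_scale.
Qed.

Lemma trace1_contractions_convex :
  convex_set (G : set (convex_lmodType 'cV[R]_d)) ->
  convex_set (S : set (convex_lmodType 'M[R]_d)).
Proof.
move=> convG A B t /set_mem[AG trA] /set_mem[BG trB]; apply/mem_set; split.
  move=> x Gx.
  have := convG (A *m x) (B *m x) t (mem_set (AG _ Gx)) (mem_set (BG _ Gx)).
  by move/set_mem; rewrite /conv/= mulmxDl -!scalemxAl.
by rewrite /conv/= mxtraceD !mxtraceZ trA trB !mulr1 addrC subrK.
Qed.

Variables (e M : R).
Hypotheses (d2 : (2 <= d)%N) (e0 : 0 < e) (eG : forall x, `|x| <= e -> G x).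
Hypotheses (cG : closed G) (GM : forall x, G x -> `|x| <= M).
Hypothesis convG : forall t x y, 0 <= t <= 1 -> G x -> G y ->
  G (t *: x + (1 - t) *: y).
Hypothesis symG : origin_symmetric G.

Let sp : sublinear p := gauge_sublinear e0 eG convG.

Lemma gaugeN x : p (- x) = p x.
Proof.
congr inf; rewrite predeqE => r; rewrite /= scalerN.
by split=> -[r0 /symG]; rewrite ?opprK.
Qed.

Lemma gauge_gt0 x : x != 0 -> 0 < p x.
Proof.
move=> x0; rewrite lt_neqAle (gauge_ge0 e0 eG) andbT.
have x1 : 0 < `|x| by rewrite normr_gt0.
(* If p x were 0 then x / r would lie in G; for this r its norm is |M| + 1 > M. *)
have r0 : 0 < `|x| / (`|M| + 1) by rewrite divr_gt0// ltr_wpDl.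
apply/eqP => px; move: (r0); rewrite {1}px => /(gauge_lt e0 eG convG)/GM.
rewrite normrZ gtr0_norm ?invr_gt0// invf_div divfK ?gt_eqF//.
by have := ler_norm M; lra.
Qed.

Lemma trace1_contractions_gauge A y : S A -> p (A *m y) <= p y.
Proof.
move=> [AG _]; apply/ler_addgt0Pr => r r0; apply: gauge_le.
  by have := gauge_ge0 e0 eG y; lra.
rewrite scalemxAr; apply: AG; apply: (gauge_lt e0 eG convG); lra.
Qed.

(** For A = x f / p x the trace is f x / p x = 1. By symmetry of G also - f y <= p y, so that p (A
    y) = |f y| <= p y. *)
Lemma norming_projection x : x != 0 -> exists A (f : 'rV[R]_d),
  [/\ S A, forall y, A *m y = ((f *m y) 0 0 / p x) *: x,
      (f *m x) 0 0 = p x & forall y, (f *m y) 0 0 <= p y].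
Proof.
move=> x0; have px := gauge_gt0 x0; have [pD pZ] := sp.
have [f [fp fx]] := hahn_banach_cV x sp.
have AE y : ((p x)^-1 *: (x *m f)) *m y = ((f *m y) 0 0 / p x) *: x.
  by rewrite -scalemxAl -mulmxA {1}[f *m y]mx11_scalar mul_mx_scalar scalerA mulrC.
exists ((p x)^-1 *: (x *m f)), f; split => //; split; last first.
  by rewrite mxtraceZ mxtrace_mulC trace_mx11 fx mulVf// gt_eqF.
move=> y /(gauge_le1 e0 eG cG convG) py.
apply/(gauge_le1 e0 eG cG convG); rewrite AE.
have fN : - (f *m y) 0 0 <= p y by have := fp (- y); rewrite gaugeN mulmxN mxE.
apply: le_trans py.
have [f0|f0] := leP 0 ((f *m y) 0 0).
  rewrite pZ; first by rewrite divfK ?gt_eqF.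
  by rewrite divr_ge0// ltW.
rewrite -gaugeN -scaleNr -mulNr pZ; first by rewrite divfK ?gt_eqF.
by rewrite divr_ge0//; lra.
Qed.

(** The vectors e times a standard basis vector lie in G, hence so do their images under A, which
    bounds every entry of A by M / e. *)
Lemma trace1_contractions_compact : compact S.
Proof.
apply: (bounded_closed_compact_mx (c := M / e)); last exact: trace1_contractions_closed.
have M0 : 0 <= M by have := @GM 0; rewrite normr0; apply; apply: eG; rewrite normr0 ltW.
move=> A [AG _]; apply: mx_norm_le => [|i j]; first by rewrite divr_ge0// ltW.
rewrite ler_pdivlMr// -(gtr0_norm e0) -normrM.
have <- : (A *m (e *: delta_mx j (0 : 'I_1))) i 0 = A i j * e.
  by rewrite -scalemxAr -colE !mxE mulrC.
apply: le_trans (mx_entry_norm _ _ _) (GM (AG _ (eG _))).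
rewrite normrZ gtr0_norm// ler_piMr ?(ltW e0)//; apply: mx_norm_le => // k l.
by rewrite mxE; case: (_ && _); rewrite ?normr1 ?normr0.
Qed.

Lemma exists_nonzero : exists x : 'cV[R]_d, x != 0.
Proof.
exists (const_mx 1); apply/eqP => /matrixP/(_ (Ordinal (ltnW d2)) 0).
by rewrite !mxE => /eqP; rewrite oner_eq0.
Qed.

Lemma norming_projection_fix (x : 'cV[R]_d) : x != 0 -> exists2 A, S A & A *m x = x.
Proof.
move=> x0; have [A [f [SA Ay fx _]]] := norming_projection x0; exists A => //.
by rewrite Ay fx divff ?scale1r// gt_eqF// gauge_gt0.
Qed.

Lemma trace1_contraction_fixing (x : 'cV[R]_d) : exists2 A, S A & A *m x = x.
Proof.
have [->|/norming_projection_fix//] := eqVneq x 0.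
have [y /norming_projection_fix[A SA _]] := exists_nonzero.
by exists A => //; rewrite mulmx0.
Qed.

Lemma trace1_contractions_irreducible : irreducible S.
Proof.
move=> U Uinv; have [->|U0] := eqVneq U 0%VS; [by left|right].
have [pD pZ] := sp.
set u := vpick U; have uU : u \in U := memv_pick U.
have u0 : u != 0 by rewrite vpick0.
have pu := gauge_gt0 u0.
apply/vspaceP => v; rewrite memvf.
have pv : 0 <= p v := gauge_ge0 e0 eG v.
(* With 4 s p v < p u, both p x >= p u - s p v and f u = p x - s f v >= p u - 2 s p v are
   positive. *)
pose s := p u / (4 * (p v + 1)).
have s0 : 0 < s by rewrite divr_gt0//; lra.
have spv : 4 * (s * p v) < p u.
  have -> : p u = s * (4 * (p v + 1)) by rewrite divfK//; lra.
  by rewrite mulrCA ltr_pM2l//; lra.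
pose x := u + s *: v.
have px : p u <= p x + s * p v.
  by have := pD x (s *: - v); rewrite scalerN addrK -scalerN pZ ?(ltW s0)// gaugeN.
have x0 : x != 0.
  by apply/eqP => x0; move: px; rewrite x0 (sublinear0 sp); lra.
have [A [f [SA Ay fx fp]]] := norming_projection x0.
have fu : 0 < (f *m u) 0 0.
  have : (f *m x) 0 0 = (f *m u) 0 0 + s * (f *m v) 0 0.
    by rewrite mulmxDr -scalemxAr !mxE.
  rewrite fx; have := ler_wpM2l (ltW s0) (fp v); lra.
(* The projection sends u to a positive multiple of x. *)
have xU : x \in U.
  have := Uinv A SA u uU; rewrite Ay => /(memvZ ((f *m u) 0 0 / p x)^-1).
  rewrite scalerA mulVf ?scale1r// gt_eqF// divr_gt0//; exact: gauge_gt0.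
have := memvB xU uU; rewrite addrAC subrr add0r => /(memvZ s^-1).
by rewrite scalerA mulVf ?scale1r// gt_eqF.
Qed.

Lemma trace1_contractions_growth (beta : R) :
  (forall x, trajectory S x ->
     exists C : R, forall t : R, 0 <= t -> `|x t| <= C * expR (beta * t)) ->
  1 <= beta.
Proof.
move=> grow; have [v v0] := exists_nonzero.
have [A SA Av] := norming_projection_fix v0.
have [C Cv] := grow _ (exp_trajectory SA Av).
rewrite leNgt; apply/negP => beta1.
have nv : 0 < `|v| by rewrite normr_gt0.
(* At this time e^((1 - beta) t) |v| >= (1 + |C| / |v|) |v| = |v| + |C| > C. *)
pose t := `|C| / `|v| / (1 - beta).
have t0 : 0 <= t by rewrite !divr_ge0//; lra.
have := Cv _ t0; rewrite normrZ gtr0_norm ?expR_gt0//.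
rewrite -ler_pdivrMr ?expR_gt0// mulrAC -expRN -expRD.
have -> : t - beta * t = `|C| / `|v|.
  rewrite -[X in X - _](mul1r t) -mulrBl mulrC divfK//.
  by rewrite gt_eqF// subr_gt0.
have := ler_wpM2r (ltW nv) (expR_ge1Dx (`|C| / `|v|)).
rewrite mulrDl mul1r divfK ?gt_eqF//; have := ler_norm C; lra.
Qed.

Lemma trace1_contractions_switching :
  convex_set (G : set (convex_lmodType 'cV[R]_d)) -> switching_system S.
Proof.
move=> cvxG; split.
- by have [A SA _] := trace1_contraction_fixing 0; exists A.
- exact: trace1_contractions_compact.
- exact: trace1_contractions_convex.
(* A zero normalized matrix means that A is the exponent times I, so d times the exponent is 1. An
   exponent at least 1 is then impossible, as d >= 2. *)
- move=> [A [_ trA] /eqP]; rewrite subr_eq0 => /eqP AE.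
  move: trA; rewrite AE mxtrace_scalar; rewrite /lyapunov.
  set B := [set beta | _].
  (* B is in fact nonempty, but the junk value [inf set0 = 0] differs from 1 / d
     as well. *)
  have [->|/set0P B0] := eqVneq B set0.
    by rewrite inf0 mul0rn => /eqP; rewrite eq_sym oner_eq0.
  have L1 : 1 <= inf B by apply: lb_le_inf => // beta /trace1_contractions_growth.
  move=> L; suff : 2 <= 1 :> R by lra.
  rewrite -[leRHS]L -[inf B *+ d]mulr_natl.
  by apply: (@le_trans _ _ d%:R); rewrite ?ler_nat// ler_peMr.
Qed.

Lemma trace1_contractions_eigenset : compact G -> eigenset S G.
Proof.
move=> compG; have G0 : G 0 by apply: eG; rewrite normr0 ltW.
have g1 x := gauge_le1 e0 eG cG convG x.
split => //; first by exists 0.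
  move=> GE; have [v v0] := exists_nonzero.
  have ev : 0 < e / `|v| by rewrite divr_gt0// normr_gt0.
  have : G ((e / `|v|) *: v).
    by apply: eG; rewrite normrZ (gtr0_norm ev) divfK// normr_eq0.
  by rewrite GE => /eqP; rewrite scaler_eq0 (negbTE v0) orbF gt_eqF.
exists 1 => t t0; rewrite mul1r predeqE => y; split.
  move=> [x [xtraj /g1 Gx0] <-].
  have : p (x t) <= expR t * p (x 0).
    apply: (trajectory_sublinear_growth (K := e^-1) sp _ _ _ _ _ xtraj) => //.
    - by rewrite invr_gt0.
    - exact: gauge_ge0 e0 eG.
    - exact: gauge_norm e0 eG convG.
    - exact: gaugeN.
    - exact: trace1_contractions_gauge.
  move=> xt; exists (expR (- t) *: x t).
    apply/g1; have [_ pZ] := sp; rewrite pZ ?expR_ge0//.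
    apply: le_trans Gx0; rewrite -(ler_pM2l (expR_gt0 t)) mulrA -expRD subrr.
    by rewrite expR0 mul1r.
  by rewrite scalerA -expRD subrr expR0 scale1r.
(* Conversely, e^t v is reached from v under the constant law A that fixes v. *)
move=> [v Gv <-]; have [A SA Av] := trace1_contraction_fixing v.
exists (fun s => expR s *: v) => //; split; first exact: exp_trajectory SA Av.
by rewrite expR0 scale1r.
Qed.

End TraceOneContractions.

Theorem theorem8 (R : realType) (d : nat) (G : set 'cV[R]_d) :
  (2 <= d)%N -> convex_body G -> origin_symmetric G -> realizable G.
Proof.
move=> d2 [compG cvxG [a]] + symG.
move=> /nbhs_ballP[r /= r0 rG].
have convG t x y : 0 <= t <= 1 -> G x -> G y -> G (t *: x + (1 - t) *: y).
  move=> /andP[t0 t1] Gx Gy.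
  by have := cvxG x y (Itv01 t0 t1) (mem_set Gx) (mem_set Gy) => /set_mem.
have e0 : 0 < r / 2 by rewrite divr_gt0.
have eG x : `|x| <= r / 2 -> G x.
  move=> xr.
  (* By symmetry G contains a + x and - (a - x), whose midpoint is x; the ball around a thus moves
     to 0. Halving r puts a closed ball inside the open one. *)
  have ball y : `|y| <= r / 2 -> G (a + y).
    move=> yr; apply: rG; rewrite -ball_normE/= opprD addrA subrr add0r normrN; lra.
  have Gx1 := ball _ xr; have := ball (- x); rewrite normrN => /(_ xr)/symG Gx2.
  have := convG 2^-1 _ _ ltac:(lra) Gx1 Gx2.
  have -> : 1 - 2^-1 = 2^-1 :> R by field.
  by rewrite -scalerDr opprB addrCA [a + x]addrC addrK -mulr2n
    -[x *+ 2]scaler_nat scalerA mulVf// scale1r.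
have cG : closed G := compact_closed (@norm_hausdorff _ _) compG.
have [M [_ GM]] := compact_bounded compG.
(* Boundedness provides every bound strictly above M, so M + 1 is taken. *)
have {}GM x : G x -> `|x| <= M + 1 by apply: GM; lra.
exists (trace1_contractions G); split.
- exact: trace1_contractions_switching d2 e0 eG cG GM convG symG cvxG.
- exact: trace1_contractions_irreducible e0 eG cG GM convG symG.
- exact: trace1_contractions_eigenset d2 e0 eG cG GM convG symG compG.
Qed.
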